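(* For every $n\ge1$, the theory $VO_n$ has elimination of imaginaries in the language $\mathcal{L}_n^*$.
   Context: Let $\mathcal{L}_n^*$ be the $(n+1)$-sorted language with sorts $R_0, \ldots, R_n$, binary relation symbols $<_1,\ldots,<_n$ with $<_i$ on sort $R_i$, a constant symbol $0$ of sort $R_0$, and function symbols $f_i: R_0 \to R_i$ and $g_i: R_i \to R_0$ for $i=1,\ldots,n$. $VO_n$ is the $\mathcal{L}_n^*$-theory axiomatized by: (1) each $<_i$ is a dense linear order without endpoints on $R_i$; (2) each $f_i$ is injective; (3) $g_i(x)=f_i^{-1}(x)$ if $x \in f_i(R_0)$ and $g_i(x)=0$ otherwise; (4) $f_i(R_0)$ is $<_i$-dense and $<_i$-co-dense in $R_i$; (5) whenever $a_i <_i b_i$ in $R_i$ for all $i$, there is $x_0 \in R_0$ with $a_i <_i f_i(x_0) <_i b_i$ for all $i$. *)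

(* Defs.v *)
From HB Require Import structures.
From mathcomp Require Import all_boot.
From Stdlib Require Import RelationClasses.

Set Implicit Arguments.
Unset Strict Implicit.
Unset Printing Implicit Defensive.

(* Many-sorted first-order logic with equality.  A tuple of variables is a    *)
(* type V together with sg : V -> sorts L giving the sort of each variable; a *)
(* tuple of elements of a structure M of these sorts is a dependent function  *)
(* forall v : V, M (sg v).  Arities are presented in the same way.            *)

Record signature := Signature {
  sorts : Type;
  funcs : Type;
  farity : funcs -> finType;
  fdom : forall f : funcs, farity f -> sorts;
  fcod : funcs -> sorts;
  rels : Type;
  rarity : rels -> finType;
  rdom : forall r : rels, rarity r -> sorts }.

Record structure (L : signature) := Structure {
  carrier :> sorts L -> Type;
  fint : forall f : funcs L,
    (forall a : farity f, carrier (fdom a)) -> carrier (fcod f);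
  rint : forall r : rels L, (forall a : rarity r, carrier (rdom a)) -> Prop }.

Inductive term (L : signature) (V : Type) (sg : V -> sorts L) :
    sorts L -> Type :=
| Var (v : V) : term sg (sg v)
| App (f : funcs L) (t : forall a : farity f, term sg (fdom a)) :
    term sg (fcod f).

(* A quantifier over sort s binds the new variable None : option V. *)
Inductive formula (L : signature) (V : Type) (sg : V -> sorts L) : Type :=
| Fls
| Eq (s : sorts L) (t u : term sg s)
| Rel (r : rels L) (t : forall a : rarity r, term sg (rdom a))
| And (p q : formula sg)
| Or (p q : formula sg)
| Imp (p q : formula sg)
| All (s : sorts L) (p : formula (oapp sg s))
| Ex (s : sorts L) (p : formula (oapp sg s)).

Arguments Var {L V sg} v.
Arguments App {L V sg} f t.
Arguments Fls {L V sg}.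
Arguments Eq {L V sg s} t u.
Arguments Rel {L V sg} r t.
Arguments And {L V sg} p q.
Arguments Or {L V sg} p q.
Arguments Imp {L V sg} p q.
Arguments All {L V sg} s p.
Arguments Ex {L V sg} s p.

Definition Not L V (sg : V -> sorts L) (p : formula sg) : formula sg :=
  Imp p Fls.

Definition BigAnd L V (sg : V -> sorts L) (ps : seq (formula sg)) :
    formula sg :=
  foldr And (Imp Fls Fls) ps.

Definition env L (M : structure L) V (sg : V -> sorts L) :=
  forall v : V, M (sg v).

Definition env_cons L (M : structure L) V (sg : V -> sorts L) (e : env M sg)
    (s : sorts L) (m : M s) : env M (oapp sg s) :=
  fun o => match o return M (oapp sg s o) with
           | Some v => e v
           | None => m
           end.

Fixpoint teval L (M : structure L) V (sg : V -> sorts L) (e : env M sg)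
    (s : sorts L) (t : term sg s) : M s :=
  match t with
  | Var v => e v
  | App f ts => fint (fun a => teval e (ts a))
  end.

Fixpoint sat L (M : structure L) V (sg : V -> sorts L) (e : env M sg)
    (p : formula sg) : Prop :=
  match p in formula _ return env M _ -> Prop with
  | Fls => fun _ => False
  | Eq _ t u => fun e => teval e t = teval e u
  | Rel r ts => fun e => rint (fun a => teval e (ts a))
  | And p q => fun e => sat e p /\ sat e q
  | Or p q => fun e => sat e p \/ sat e q
  | Imp p q => fun e => sat e p -> sat e q
  | All s p => fun e => forall m : M s, sat (env_cons e m) p
  | Ex s p => fun e => exists m : M s, sat (env_cons e m) p
  end e.

(* Free variables of the members of a theory are universally quantified. *)
Definition theory (L : signature) :=
  forall (V : finType) (sg : V -> sorts L), formula sg -> Prop.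

Definition models L (M : structure L) (T : theory L) : Prop :=
  forall (V : finType) (sg : V -> sorts L) (p : formula sg),
    T V sg p -> forall e : env M sg, sat e p.

Definition sort_cat L V W (sg : V -> sorts L) (tu : W -> sorts L) :
    V + W -> sorts L :=
  fun u => match u with inl v => sg v | inr w => tu w end.

Definition env_cat L (M : structure L) V W (sg : V -> sorts L)
    (tu : W -> sorts L) (a : env M sg) (b : env M tu) :
    env M (sort_cat sg tu) :=
  fun u => match u return M (sort_cat sg tu u) with
           | inl v => a v
           | inr w => b w
           end.

(* In every model, each class of a 0-definable equivalence relation on a      *)
(* finite product of sorts is phi(M, b) for some formula phi and a unique     *)
(* tuple b of elements of the sorts, that is, each imaginary is               *)
(* interdefinable with a real tuple.  The stronger uniform version (every     *)
(* such relation is the kernel of a 0-definable map into a product of sorts)  *)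
(* is not what is meant: it needs two 0-definable elements in one sort.       *)
Definition elimination_of_imaginaries L (T : theory L) : Prop :=
  forall M : structure L, models M T ->
  forall (X : finType) (sg : X -> sorts L) (E : formula (sort_cat sg sg)),
  Equivalence (fun x y : env M sg => sat (env_cat x y) E) ->
  forall a : env M sg,
  exists (Z : finType) (tu : Z -> sorts L) (phi : formula (sort_cat sg tu)),
  exists! b : env M tu,
  forall x : env M sg, sat (env_cat x b) phi <-> sat (env_cat a x) E.

(* The indices 1, ..., n are represented by 'I_n. *)

Inductive vo_sort (n : nat) := R0 | R of 'I_n.
Inductive vo_func (n : nat) := Zero | F of 'I_n | G of 'I_n.
Inductive vo_rel (n : nat) := Lt of 'I_n.

Arguments R0 {n}.
Arguments Zero {n}.

Definition vo_farity n (f : vo_func n) : finType :=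
  match f with Zero => void | F _ => unit | G _ => unit end.

Definition vo_fdom n (f : vo_func n) (_ : vo_farity f) : vo_sort n :=
  match f with Zero => R0 | F _ => R0 | G i => R i end.

Definition vo_fcod n (f : vo_func n) : vo_sort n :=
  match f with Zero => R0 | F i => R i | G _ => R0 end.

Definition vo_rdom n (r : vo_rel n) (_ : bool) : vo_sort n :=
  match r with Lt i => R i end.

Definition vo_lang (n : nat) : signature :=
  @Signature (vo_sort n) (vo_func n) (@vo_farity n) (@vo_fdom n) (@vo_fcod n)
    (vo_rel n) (fun _ => bool) (@vo_rdom n).

Section VOSyntax.
Context {n : nat} {V : Type} {sg : V -> sorts (vo_lang n)}.
Implicit Type i : 'I_n.

Definition tzero : term sg (R0 : sorts (vo_lang n)) :=
  @App (vo_lang n) V sg Zero (fun a : void => match a with end).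

Definition tf i (t : term sg (R0 : sorts (vo_lang n))) :
    term sg (R i : sorts (vo_lang n)) :=
  @App (vo_lang n) V sg (F i) (fun _ : unit => t).

Definition tg i (t : term sg (R i : sorts (vo_lang n))) :
    term sg (R0 : sorts (vo_lang n)) :=
  @App (vo_lang n) V sg (G i) (fun _ : unit => t).

(* The first argument of <_i has position true. *)
Definition flt i (t u : term sg (R i : sorts (vo_lang n))) : formula sg :=
  @Rel (vo_lang n) V sg (Lt i) (fun b : bool => if b then t else u).

End VOSyntax.

Arguments tf {n V sg} i t.
Arguments tg {n V sg} i t.
Arguments flt {n V sg} i t u.

Definition no_var n : void -> sorts (vo_lang n) := fun v => match v with end.

Definition box_sort n : 'I_n + 'I_n -> sorts (vo_lang n) :=
  fun u => match u with inl i => R i | inr i => R i end.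

(* De Bruijn indices. *)
Local Notation "#0" := (Var None).
Local Notation "#1" := (Var (Some None)).
Local Notation "#2" := (Var (Some (Some None))).

Section VOSentences.
Context {n : nat} (i : 'I_n).
Let Ri : sorts (vo_lang n) := R i.
Let R0' : sorts (vo_lang n) := R0.
Local Notation sentence := (formula (@no_var n)).

Definition ax_lt_irrefl : sentence := All Ri (Not (flt i #0 #0)).

Definition ax_lt_trans : sentence :=
  All Ri (All Ri (All Ri
    (Imp (And (flt i #2 #1) (flt i #1 #0)) (flt i #2 #0)))).

Definition ax_lt_total : sentence :=
  All Ri (All Ri (Or (flt i #1 #0) (Or (@Eq _ _ _ Ri #1 #0) (flt i #0 #1)))).

Definition ax_lt_dense : sentence :=
  All Ri (All Ri (Imp (flt i #1 #0) (Ex Ri (And (flt i #2 #0) (flt i #0 #1))))).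

Definition ax_lt_no_min : sentence := All Ri (Ex Ri (flt i #0 #1)).

Definition ax_lt_no_max : sentence := All Ri (Ex Ri (flt i #1 #0)).

Definition ax_f_inj : sentence :=
  All R0' (All R0' (Imp (Eq (tf i #1) (tf i #0)) (@Eq _ _ _ R0' #1 #0))).

Definition ax_g_image : sentence :=
  All Ri (All R0' (Imp (Eq (tf i #0) #1) (Eq (tg i #1) #0))).

Definition ax_g_nonimage : sentence :=
  All Ri (Imp (Not (Ex R0' (Eq (tf i #0) #1))) (Eq (tg i #0) tzero)).

Definition ax_f_image_dense : sentence :=
  All Ri (All Ri (Imp (flt i #1 #0)
    (Ex R0' (And (flt i #2 (tf i #0)) (flt i (tf i #0) #1))))).

Definition ax_f_image_codense : sentence :=
  All Ri (All Ri (Imp (flt i #1 #0)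
    (Ex Ri (And (Not (Ex R0' (Eq (tf i #0) #1)))
                (And (flt i #2 #0) (flt i #0 #1)))))).

End VOSentences.

(* The free variables inl i and inr i are a_i and b_i. *)
Definition ax_f_joint_dense n : formula (@box_sort n) :=
  Imp (BigAnd [seq flt i (Var (inl i)) (Var (inr i)) | i <- enum 'I_n])
      (Ex (R0 : sorts (vo_lang n))
         (BigAnd [seq And (flt i (Var (Some (inl i))) (tf i #0))
                          (flt i (tf i #0) (Var (Some (inr i))))
                 | i <- enum 'I_n])).

Inductive VO (n : nat) : theory (vo_lang n) :=
| VO_lt_irrefl (i : 'I_n) : VO (ax_lt_irrefl i)
| VO_lt_trans (i : 'I_n) : VO (ax_lt_trans i)
| VO_lt_total (i : 'I_n) : VO (ax_lt_total i)
| VO_lt_dense (i : 'I_n) : VO (ax_lt_dense i)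
| VO_lt_no_min (i : 'I_n) : VO (ax_lt_no_min i)
| VO_lt_no_max (i : 'I_n) : VO (ax_lt_no_max i)
| VO_f_inj (i : 'I_n) : VO (ax_f_inj i)
| VO_g_image (i : 'I_n) : VO (ax_g_image i)
| VO_g_nonimage (i : 'I_n) : VO (ax_g_nonimage i)
| VO_f_image_dense (i : 'I_n) : VO (ax_f_image_dense i)
| VO_f_image_codense (i : 'I_n) : VO (ax_f_image_codense i)
| VO_f_joint_dense : VO (@ax_f_joint_dense n).

Arguments VO n V sg p : clear implicits.

(* Main.v *)
Require Import Defs.
From mathcomp Require Import all_boot.
From Stdlib Require Import Classical FunctionalExtensionality RelationClasses.
From Stdlib Require List.

(* Over finite parameter sets, the type of a tuple is the order pattern of the
   elements of the R_i that it generates, and by back and forth this pattern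
   decides every formula.  Up to interdefinability a parameter is either in R_0
   or in R_i outside the image of f_i.  Let C be a class, and let b be a tuple of
   such parameters of minimal length such that C is invariant under equality of
   types over b; then C = phi(M, b) where phi says that (x, b) has the type of
   some (x0, b) with x0 in C.  If phi(M, b') = C as well, then b' has the type of
   b, and every entry of b is an entry of b': otherwise C would be invariant over
   a proper part of b ([inv_remove]).  The resulting self-map of the finite index
   set preserves the orders, so it moves nothing and b' = b. *)

Set Implicit Arguments.
Unset Strict Implicit.
Unset Printing Implicit Defensive.

(** * Finite types, finite orders and definability from finitely many formulas *)

Lemma sat_BigAnd L (N : structure L) V (sg : V -> sorts L) (e : env N sg)
    (T : eqType) (s : seq T) (p : T -> formula sg) :
  sat e (BigAnd [seq p i | i <- s]) <-> forall i, i \in s -> sat e (p i).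
Proof.
elim: s => [|i s IH] /=; first by split=> // _ [].
split=> [[h1 /IH h2] j|h]; first by rewrite inE => /orP[/eqP->|/h2].
by split; [apply: h; rewrite mem_head | apply/IH => j hj; apply: h; rewrite inE hj orbT].
Qed.

Definition finite (T : Type) : Prop := exists l : seq T, forall x, List.In x l.

Lemma finite_option T : finite T -> finite (option T).
Proof.
case=> l hl; exists (None :: List.map Some l) => -[x|]; [right | by left].
exact/List.in_map.
Qed.

Lemma finite_finType (T : finType) : finite T.
Proof.
exists (enum T) => x; have: x \in enum T by rewrite mem_enum.
by elim: (enum T) => // y s IH; rewrite inE => /orP[/eqP->|/IH]; [left|right].
Qed.

Lemma finite_posn V : finite V -> finite (option (V * bool)).
Proof.
case=> l hl; apply: finite_option; exists (List.list_prod l [:: true; false]).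
by case=> v b; apply/List.in_prod; [exact: hl | case: b; rewrite /=; auto].
Qed.

(** If [r x (f x)], the iterates of [f] at [x] increase strictly; on a finite type injectivity
    brings them back to [x], against irreflexivity. *)
Lemma order_automorphism_fix (T : finType) (r : T -> T -> Prop) (f : T -> T) x :
  (forall x, ~ r x x) -> (forall x y z, r x y -> r y z -> r x z) ->
  injective f -> (forall x y, r x y -> r (f x) (f y)) -> ~ r x (f x).
Proof.
move=> irr tr fI hf xf.
have h k : r x (iter k.+1 f x).
  elim: k => [//|k IH] /=; apply: tr xf _; exact: hf.
apply: (irr x); rewrite -{2}(iter_order fI x).
by have := order_gt0 f x; case: (order f x) => // k _; apply: h.
Qed.

Lemma least_nat (P : nat -> Prop) m : P m ->
  exists k, P k /\ forall j, j < k -> ~ P j.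
Proof.
elim/ltn_ind: m => m IH Pm.
have [[j [jm Pj]]|h] := classic (exists j, j < m /\ P j); first exact: IH Pj.
by exists m; split=> // j jm Pj; apply: h; exists j.
Qed.

Lemma definable_by_list L (M : structure L) V (sg : V -> sorts L) T (p : T -> formula sg)
    (l : seq T) (D : env M sg -> Prop) :
  (forall e e', (forall t, List.In t l -> sat e (p t) <-> sat e' (p t)) ->
    D e -> D e') ->
  exists phi, forall e, sat e phi <-> D e.
Proof.
elim: l D => [|t l IH] D HD.
  have [[e De]|nD] := classic (exists e, D e).
    by exists (Imp Fls Fls) => e'; split=> [_|_ []]; apply: HD De => ? [].
  by exists Fls => e; split=> // De; apply: nD; exists e.
(* [D1 id] and [D1 not] saturate the parts of [D] where [p t] holds and fails, so that they depend
   on the remaining formulas only. *)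
pose D1 (q : Prop -> Prop) (e : env M sg) := exists e' : env M sg, [/\ D e', q (sat e' (p t)) &
  forall t', List.In t' l -> sat e' (p t') <-> sat e (p t')].
have cl q e e' : (forall t, List.In t l -> sat e (p t) <-> sat e' (p t)) ->
    D1 q e -> D1 q e'.
  move=> h [e1 [De1 q1 h1]]; exists e1; split=> // t' ht'.
  by rewrite h1 // h.
have [f1 hf1] := IH _ (cl id); have [f2 hf2] := IH _ (cl not).
exists (Or (And (p t) f1) (And (Not (p t)) f2)) => e /=.
rewrite hf1 hf2; split.
  by case=> -[et [e1 [De1 q1 h1]]]; apply: (HD e1) De1 => t' [<-|/h1] //; tauto.
move=> De; have [et|et] := classic (sat e (p t)); [left|right]; split=> //;
  by exists e.
Qed.

(** * The axioms read inside a model *)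

Section Model.
Context {n : nat} (hn : 0 < n) (M : structure (vo_lang n)).
Context (MVO : models M (VO n)).

Definition lt i (x y : M (R i)) : Prop :=
  @rint (vo_lang n) M (Lt i) (fun b : bool => if b then x else y).

Definition ff i (x : M (@R0 n)) : M (R i) :=
  @fint (vo_lang n) M (F i) (fun _ : unit => x).

Definition gg i (y : M (R i)) : M (@R0 n) :=
  @fint (vo_lang n) M (G i) (fun _ : unit => y).

Definition zero : M (@R0 n) :=
  @fint (vo_lang n) M Zero (fun a : void => match a with end).

Lemma sat_flt V (sg : V -> sorts (vo_lang n)) (e : env M sg) i t u :
  sat e (flt i t u) <-> lt (teval e t) (teval e u).
Proof.
rewrite /flt /lt /=; set a := (fun b => teval e _); set b := (fun b => _).
suff -> : a = b by [].
by apply: functional_extensionality_dep => -[].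
Qed.

Lemma sat_Rel_Lt V (sg : V -> sorts (vo_lang n)) (e : env M sg) i
    (t : bool -> term sg (R i : sorts (vo_lang n))) :
  sat e (@Rel (vo_lang n) V sg (Lt i) t) <->
  lt (teval e (t true)) (teval e (t false)).
Proof.
rewrite /lt /=; set a := (fun b => teval e _); set b := (fun b => _).
suff -> : a = b by [].
by apply: functional_extensionality_dep => -[].
Qed.

Lemma teval_zero V (sg : V -> sorts (vo_lang n)) (e : env M sg) t :
  teval e (@App (vo_lang n) V sg Zero t) = zero.
Proof.
by apply: (f_equal (@fint (vo_lang n) M Zero));
  apply: functional_extensionality_dep => -[].
Qed.

Lemma teval_tf V (sg : V -> sorts (vo_lang n)) (e : env M sg) i t :
  teval e (@App (vo_lang n) V sg (F i) t) = ff i (teval e (t tt)).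
Proof.
by apply: (f_equal (@fint (vo_lang n) M (F i)));
  apply: functional_extensionality_dep => -[].
Qed.

Lemma teval_tg V (sg : V -> sorts (vo_lang n)) (e : env M sg) i t :
  teval e (@App (vo_lang n) V sg (G i) t) = gg (teval e (t tt)).
Proof.
by apply: (f_equal (@fint (vo_lang n) M (G i)));
  apply: functional_extensionality_dep => -[].
Qed.

Let e0 : env M (@no_var n) := fun v => match v with end.

Lemma lt_irr i (x : M (R i)) : ~ lt x x.
Proof. by move=> h; have /= := MVO (VO_lt_irrefl i) e0 x; apply; apply/sat_flt. Qed.

Lemma lt_trans i (x y z : M (R i)) : lt x y -> lt y z -> lt x z.
Proof.
move=> h1 h2; have /= H := MVO (VO_lt_trans i) e0 x y z.
suff /H /sat_flt : sat (env_cons (env_cons (env_cons e0 x) y) z)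
    (And (flt i (Var (Some (Some None))) (Var (Some None)))
         (flt i (Var (Some None)) (Var None))) by [].
by split; apply/sat_flt.
Qed.

Lemma lt_total i (x y : M (R i)) : lt x y \/ x = y \/ lt y x.
Proof.
by have /= [/sat_flt|[|/sat_flt]] := MVO (VO_lt_total i) e0 x y; auto.
Qed.

Lemma lt_no_min i (x : M (R i)) : exists y, lt y x.
Proof. by have /= [y /sat_flt] := MVO (VO_lt_no_min i) e0 x; exists y. Qed.

Lemma lt_no_max i (x : M (R i)) : exists y, lt x y.
Proof. by have /= [y /sat_flt] := MVO (VO_lt_no_max i) e0 x; exists y. Qed.

Lemma ff_inj i : injective (ff i).
Proof. by move=> x y h; exact: (MVO (VO_f_inj i) e0 x y). Qed.

Lemma ffK i (x : M (@R0 n)) : gg (ff i x) = x.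
Proof. exact: (MVO (VO_g_image i) e0 (ff i x) x). Qed.

Lemma gg_nonimage i (y : M (R i)) : (forall x, ff i x <> y) -> gg y = zero.
Proof.
move=> h; have /= H := MVO (VO_g_nonimage i) e0 y.
rewrite -[RHS](teval_zero (env_cons e0 y) (fun a : void => match a with end)).
by apply: H => -[x /h].
Qed.

Lemma codense i (x y : M (R i)) : lt x y ->
  exists z, (forall w, ff i w <> z) /\ lt x z /\ lt z y.
Proof.
move=> h; have /= H := MVO (VO_f_image_codense i) e0 x y.
have [|z [h1 [/sat_flt h2 /sat_flt h3]]] := H; first exact/sat_flt.
by exists z; split=> // w hw; apply: h1; exists w.
Qed.

Lemma joint_dense (u v : forall i, M (R i)) : (forall i, lt (u i) (v i)) ->
  exists x, forall i, lt (u i) (ff i x) /\ lt (ff i x) (v i).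
Proof.
move=> h; pose e : env M (@box_sort n) := fun w =>
  match w with inl i => u i | inr i => v i end.
have /= H := MVO (@VO_f_joint_dense n) e.
have [|x /sat_BigAnd hx] := H.
  by apply/sat_BigAnd => i _; apply/sat_flt; apply: h.
exists x => i; have := hx i; rewrite mem_enum => /(_ isT) /= [/sat_flt ? /sat_flt].
by split.
Qed.

Lemma nlt_eq_or_gt i (x y : M (R i)) : ~ lt x y -> x = y \/ lt y x.
Proof. by have [|[]] := lt_total x y; auto. Qed.

(** * The elements generated by a single element *)

Definition r0 (s : vo_sort n) : M s -> M (@R0 n) :=
  match s return M s -> M R0 with R0 => id | R j => @gg j end.

Definition kk (i : 'I_n) (s : vo_sort n) : M s -> M (R i) :=
  match s return M s -> M (R i) with
  | R0 => ff i
  | R j => fun y => match @eqP _ j i with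
                    | ReflectT e => ecast k (M (R k)) e y
                    | ReflectF _ => ff i (gg y)
                    end
  end.

(* [pos false i m] and [pos true i m] exhaust the elements of sort [R i] generated
   by [m], apart from [ff i zero]. *)
Definition pos (b : bool) (i : 'I_n) (s : vo_sort n) (m : M s) : M (R i) :=
  if b then kk i m else ff i (r0 m).

Lemma kk_same i (y : M (R i)) : @kk i (R i) y = y.
Proof. by rewrite /kk; case: eqP => // e; rewrite (eq_axiomK e). Qed.

Lemma kk_diff i j (y : M (R j)) : j <> i -> @kk i (R j) y = ff i (gg y).
Proof. by rewrite /kk; case: eqP. Qed.

Lemma pos_R0 b i (x : M (@R0 n)) : @pos b i R0 x = ff i x.
Proof. by case: b. Qed.

Lemma pos_ff b i j (x : M (@R0 n)) : @pos b i (R j) (ff j x) = ff i x.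
Proof.
case: b; rewrite /pos /= ?ffK //.
by case: eqP => // e; case: i / e.
Qed.

(* The [i] for which [pos true i m] is not the default [ff i zero] when [m] is
   normal and nonzero. *)
Definition relevant (s : vo_sort n) (i : 'I_n) : Prop :=
  match s with R0 => True | R j => j = i end.

Definition normal (s : vo_sort n) : M s -> Prop :=
  match s return M s -> Prop with
  | R0 => fun _ => True
  | R j => fun y => forall x, ff j x <> y
  end.

(** On a normal element of [R j] the map [gg] gives [zero], so what it generates besides itself
    comes from the constant. A normal element thus adds at most one point to each sort [R i]. *)
Lemma pos_cases s (m m' : M s) b i : normal m -> normal m' ->
  (pos b i m = ff i zero /\ pos b i m' = ff i zero) \/
  [/\ pos b i m = pos true i m, pos b i m' = pos true i m' & relevant s i].
Proof.
case: s m m' => [|j] m m' hm hm'; first by right; rewrite !pos_R0.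
have g1 := gg_nonimage hm; have g2 := gg_nonimage hm'.
case: b; last by left; rewrite /pos /= g1 g2.
have [<-|ne] := eqVneq j i; first by right.
by left; rewrite /pos !kk_diff ?g1 ?g2 //; apply/eqP.
Qed.

Lemma pos_normal s (m : M s) :
  exists (s' : vo_sort n) (m' : M s'), normal m' /\
    forall i b, pos b i m = pos b i m'.
Proof.
case: s m => [|j] m; first by exists R0, m.
have [[x <-]|h] := classic (exists x, ff j x = m).
  by exists R0, x; split=> // i b; rewrite pos_ff pos_R0.
by exists (R j), m; split=> // x hx; apply: h; exists x.
Qed.

Lemma pos_true_same_normal s s' (m : M s) (m' : M s') :
  normal m -> normal m' -> (forall i, pos true i m = pos true i m') ->
  forall b i, pos b i m = pos b i m'.
Proof.
move=> hm hm' h [] i //.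
case: s m hm h => [|j] m hm h; case: s' m' hm' h => [|j'] m' hm' h.
- by have := h i; rewrite !pos_R0.
- by have := h j'; rewrite pos_R0 /pos kk_same => /hm'.
- by have /esym := h j; rewrite pos_R0 /pos kk_same => /hm.
- by rewrite /pos /= (gg_nonimage hm) (gg_nonimage hm').
Qed.

Lemma pos_true_inj s (m m' : M s) :
  (forall i, pos true i m = pos true i m') -> m = m'.
Proof.
case: s m m' => [|j] m m' h; last by have := h j; rewrite /pos !kk_same.
by have := h (Ordinal hn); rewrite !pos_R0 => /ff_inj.
Qed.

Lemma eq_pos_r0 b i s (m : M s) x : ff i x = pos b i m -> x = r0 m.
Proof.
case: b; rewrite /pos; last by move/ff_inj.
case: s m => [|j] m; first by move/ff_inj.
have [ji|ne] := eqVneq j i.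
  by case: i / ji => /=; case: eqP => // e; rewrite (eq_axiomK e) /= => <-; rewrite ffK.
by rewrite kk_diff; [move/ff_inj | apply/eqP].
Qed.

(** * Realizing cuts over finite sets *)

Lemma between i (l : seq (M (R i))) (lo hi : M (R i) -> Prop) :
  (forall a b, lo a -> hi b -> lt a b) ->
  exists u v, lt u v /\ (forall a, List.In a l ->
    (lo a -> ~ lt u a) /\ (hi a -> ~ lt a v)).
Proof.
(* Applied to [lt] and its converse, this picks a largest listed element of [lo] and a smallest one
   of [hi]; a missing bound is supplied by the absence of endpoints. *)
have ext (r : M (R i) -> M (R i) -> Prop) (P : M (R i) -> Prop) :
    (forall x, ~ r x x) -> (forall x y z, r x y -> r y z -> r x z) ->
    (forall a, List.In a l -> ~ P a) \/
    (exists m, P m /\ forall a, List.In a l -> P a -> ~ r m a).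
  move=> irr tr; elim: l => [|a s IH]; first by left.
  case: (classic (P a)) => Pa.
    right; case: IH => [h|[m [Pm h]]].
      by exists a; split=> // b [<-|/h] //.
    case: (classic (r m a)) => ma.
      exists a; split=> // b [<- //|hb Pb] ab; exact: (h b hb Pb (tr _ _ _ ma ab)).
    by exists m; split=> // b [<-|/h].
  case: IH => [h|[m [Pm h]]]; [left|right].
    by move=> b [<-|/h].
  by exists m; split=> // b [<-|/h].
move=> H; have [hl|[u [lu hu]]] := ext (@lt i) lo (@lt_irr i) (@lt_trans i);
  have [hh|[v [hv hv']]] := ext (fun x y => lt y x) hi (@lt_irr i)
    (fun x y z xy yz => lt_trans yz xy).
- have [v uv] := lt_no_max (ff i zero); exists (ff i zero), v; split=> // a ia.
  by split=> [/(hl _ ia)|/(hh _ ia)].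
- have [u uv] := lt_no_min v; exists u, v; split=> // a ia.
  by split=> [/(hl _ ia)|/(hv' _ ia)].
- have [v uv] := lt_no_max u; exists u, v; split=> // a ia.
  by split=> [/(hu _ ia)|/(hh _ ia)].
- exists u, v; split=> [|a ia]; first exact: H.
  by split=> [/(hu _ ia)|/(hv' _ ia)].
Qed.

(** A point of [R0] has to meet the conditions in all sorts at once, which is joint density; a
    normal point of [R j] has only one to meet, and codensity provides it. *)
Lemma box (s : vo_sort n) (u v : forall i, M (R i)) :
  (forall i, lt (u i) (v i)) ->
  exists m : M s, normal m /\ forall i, relevant s i ->
    lt (u i) (pos true i m) /\ lt (pos true i m) (v i).
Proof.
move=> uv; case: s => [|j].
  have [x hx] := joint_dense uv.
  by exists x; split=> // i _; rewrite pos_R0.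
have [y [ny hy]] := codense (uv j).
by exists y; split=> // i <-; rewrite /pos kk_same.
Qed.

(** The index does not depend on [m]; hence adjoining a position to a tuple generates nothing new,
    in the same way for two tuples of equal type. *)
Lemma pos_pos s j b i b' : exists b'', forall m : M s,
  @pos b' i (R j) (pos b j m) = pos b'' i m.
Proof.
case: b; last by exists false => m; rewrite [pos false j m]/pos pos_ff.
case: s => [|j']; first by exists false => m; rewrite pos_R0 pos_ff.
have [<-|/eqP ne] := eqVneq j' j.
  by exists b' => m; rewrite [pos true _ _]/pos kk_same.
by exists false => m; rewrite [pos true _ _]/pos kk_diff // pos_ff.
Qed.

Lemma nlt_lt_trans i (x y z : M (R i)) : ~ lt y x -> lt y z -> lt x z.
Proof. by case/nlt_eq_or_gt => [->|h] //; apply: lt_trans. Qed.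

Lemma lt_nlt_trans i (x y z : M (R i)) : lt x y -> ~ lt z y -> lt x z.
Proof. by move=> xy /nlt_eq_or_gt[->|h] //; apply: (lt_trans xy). Qed.

(** * Types of tuples and back and forth *)

Definition posn V (sg : V -> vo_sort n) (e : env M sg) i
    (k : option (V * bool)) : M (R i) :=
  if k is Some (v, b) then pos b i (e v) else ff i zero.

(* Equality of quantifier-free types: by totality the order determines equality,
   and [y] of sort [R i] is in the image of [ff i] when its two positions agree. *)
Definition equ V (sg : V -> vo_sort n) (e e' : env M sg) : Prop :=
  forall i k l, lt (posn e i k) (posn e i l) <-> lt (posn e' i k) (posn e' i l).

Lemma equ_sym V sg (e e' : @env _ M V sg) : equ e e' -> equ e' e.
Proof. by move=> h i k l; split => /h. Qed.

Lemma equ_trans V sg (e1 e2 e3 : @env _ M V sg) :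
  equ e1 e2 -> equ e2 e3 -> equ e1 e3.
Proof. by move=> h1 h2 i k l; rewrite (h1 i k l). Qed.

Lemma equ_eq V sg (e e' : @env _ M V sg) i k l : equ e e' ->
  posn e i k = posn e i l <-> posn e' i k = posn e' i l.
Proof.
move=> h; split=> H.
  by have [/h|[//|/h]] := lt_total (posn e' i k) (posn e' i l);
    rewrite H => /lt_irr.
by have [/h|[//|/h]] := lt_total (posn e i k) (posn e i l);
  rewrite H => /lt_irr.
Qed.

(** In each [R i] with [P i], the tuple [d] may have one point [u i] beyond those of [e]. With a
    single new point per sort, only its cut over [e] has to be compared. *)
Lemma equ_new V sg (e e' : @env _ M V sg) W tg (d d' : @env _ M W tg)
    (P : 'I_n -> Prop) (u u' : forall i, M (R i)) :
  (forall i w b,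
    (exists l, pos b i (d w) = posn e i l /\ pos b i (d' w) = posn e' i l) \/
    [/\ pos b i (d w) = u i, pos b i (d' w) = u' i & P i]) ->
  (forall i k, P i -> (lt (posn e i k) (u i) <-> lt (posn e' i k) (u' i)) /\
                      (lt (u i) (posn e i k) <-> lt (u' i) (posn e' i k))) ->
  equ e e' -> equ d d'.
Proof.
move=> hd hu he i.
have {}hd k : (exists l, posn d i k = posn e i l /\ posn d' i k = posn e' i l) \/
    [/\ posn d i k = u i, posn d' i k = u' i & P i].
  by case: k => [[w b]|]; [exact: hd | left; exists None].
move=> k l; have [[k1 [-> ->]]|[-> -> Pi]] := hd k;
  have [[l1 [-> ->]]|[-> -> Pj]] := hd l.
- exact: he.
- exact: (hu _ _ Pj).1.
- exact: (hu _ _ Pi).2.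
- by split=> /lt_irr.
Qed.

Lemma equ_sub V sg (e e' : @env _ M V sg) W tg (d d' : @env _ M W tg) :
  (forall i w b,
    exists l, pos b i (d w) = posn e i l /\ pos b i (d' w) = posn e' i l) ->
  equ e e' -> equ d d'.
Proof.
move=> h; apply: (@equ_new _ _ e e' _ _ d d' (fun=> False) (ff^~ zero) (ff^~ zero)) => //.
by move=> *; left; apply: h.
Qed.

Lemma between_family K i (p : K -> M (R i)) (lo hi : K -> Prop) : finite K ->
  (forall a b, lo a -> hi b -> lt (p a) (p b)) ->
  exists u v, lt u v /\ forall k, (lo k -> ~ lt u (p k)) /\ (hi k -> ~ lt (p k) v).
Proof.
case=> l hl h.
have [|u [v [uv H]]] := @between i (List.map p l)
    (fun a => exists2 k, lo k & a = p k) (fun a => exists2 k, hi k & a = p k).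
  by move=> _ _ [k hk ->] [k' hk' ->]; apply: h.
exists u, v; split=> // k; have [h1 h2] := H _ (List.in_map p _ _ (hl k)).
by split=> hk; [apply: h1 | apply: h2]; exists k.
Qed.

(** The cut of [m] over [e] is copied to [e'] in every sort and realized by [box]. Freshness
    excludes equality, so the strict inequalities also transfer backwards. *)
Lemma equ_cons_fresh V sg (e e' : @env _ M V sg) s (m : M s) : finite V ->
  normal m -> (forall i k, relevant s i -> pos true i m <> posn e i k) ->
  equ e e' -> exists m' : M s, equ (env_cons e m) (env_cons e' m').
Proof.
move=> finV nm fr he.
have cut i : exists uv : M (R i) * M (R i), lt uv.1 uv.2 /\ forall k,
    (lt (posn e i k) (pos true i m) -> ~ lt uv.1 (posn e' i k)) /\
    (lt (pos true i m) (posn e i k) -> ~ lt (posn e' i k) uv.2).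
  have [|u [v [uv H]]] := @between_family _ i (posn e' i)
    (fun k => lt (posn e i k) (pos true i m))
    (fun k => lt (pos true i m) (posn e i k)) (finite_posn finV).
    by move=> a b ha hb; apply/he; apply: lt_trans hb.
  by exists (u, v).
have [uv Huv] := fin_all_exists cut.
have [m' [nm' hm']] := @box s _ _ (fun i => (Huv i).1).
exists m'; apply: (equ_new (P := relevant s) (u := fun i => pos true i m)
    (u' := fun i => pos true i m') _ _ he) => [i [w|] b|i k ri].
- by left; exists (Some (w, b)).
- have [[h h']|[h h' ri]] := pos_cases b i nm nm'; last by right.
  by left; exists None.
have [um mv] := hm' i ri; have [h1 h2] := (Huv i).2 k.
split; split.
- by move/h1 => h; apply: nlt_lt_trans h um.
- move=> h; have [//|[E|/h2 H]] := lt_total (posn e i k) (pos true i m).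
    by have := fr i k ri; rewrite E.
  by case: H; apply: lt_trans mv.
- by move/h2 => h; apply: lt_nlt_trans mv h.
- move=> h; have [//|[E|/h1 H]] := lt_total (pos true i m) (posn e i k).
    by have := fr i k ri; rewrite E.
  by case: H; apply: lt_trans um _.
Qed.

(** Either the new element is generated by [e], and its counterpart over [e'] answers, or it is
    fresh; an image point is first replaced by its preimage. *)
Lemma equ_cons V sg (e e' : @env _ M V sg) s (m : M s) : finite V ->
  equ e e' -> exists m' : M s, equ (env_cons e m) (env_cons e' m').
Proof.
move=> finV he.
have ext0 (x : M (@R0 n)) : exists x' : M (@R0 n), equ (env_cons e x) (env_cons e' x').
  have [->|x0] := classic (x = zero).
    exists zero; apply: equ_sub he => i [w|] b; first by exists (Some (w, b)).
    by exists None; rewrite !pos_R0.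
  have [[v ->]|xv] := classic (exists v, x = r0 (e v)).
    exists (r0 (e' v)); apply: equ_sub he => i [w|] b; first by exists (Some (w, b)).
    by exists (Some (v, false)); rewrite !pos_R0.
  apply: equ_cons_fresh he => // i [[v b]|] _; rewrite pos_R0.
    by move/eq_pos_r0 => h; apply: xv; exists v.
  by move/ff_inj.
case: s m => [|j] m; first exact: ext0.
have [[x <-]|nm] := classic (exists x, ff j x = m).
  have [x' hx'] := ext0 x; exists (ff j x').
  apply: equ_sub hx' => i [w|] b; first by exists (Some (Some w, b)).
  by exists (Some (None, b)); rewrite /= !pos_ff !pos_R0.
have [[[[v b]|] ->]|km] := classic (exists k, m = posn e j k).
- exists (posn e' j (Some (v, b))); apply: equ_sub he => i [w|] b'.
    by exists (Some (w, b')).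
  have [b'' h] := pos_pos (sg v) j b i b'.
  by exists (Some (v, b'')); split; apply: h.
- exists (ff j zero); apply: equ_sub he => i [w|] b'; first by exists (Some (w, b')).
  by exists None; rewrite /= pos_ff.
apply: equ_cons_fresh he => // [x hx|i k ji]; first by apply: nm; exists x.
case: i / ji k => k h; apply: km; exists k.
by rewrite -h /pos kk_same.
Qed.

(** Under [ff] or [gg] a term is seen through its [R0] part only, so all terms collapse to finitely
    many positions, uniformly in [e]. *)
Lemma teval_pos V sg s (t : @term (vo_lang n) V sg s) i b :
  exists l, forall e : env M sg, pos b i (teval e t) = posn e i l.
Proof.
elim: t i b => [v|[|j|j] t IH] i b; first by exists (Some (v, b)).
- by exists None => e; rewrite teval_zero pos_R0.
- by have [l hl] := IH tt i false; exists l => e; rewrite teval_tf pos_ff -hl.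
- have [l hl] := IH tt i false; exists l => e; rewrite teval_tg -hl.
  by rewrite pos_R0.
Qed.

Lemma pos_detects_eq s : exists i, forall m m' : M s,
  pos true i m = pos true i m' -> m = m'.
Proof.
case: s => [|j]; first by exists (Ordinal hn) => m m'; rewrite !pos_R0 => /ff_inj.
by exists j => m m'; rewrite /pos !kk_same.
Qed.

Lemma sat_equ V sg (p : @formula (vo_lang n) V sg) (e e' : env M sg) :
  finite V -> equ e e' -> sat e p <-> sat e' p.
Proof.
elim: p e e' => {V sg} [V sg|V sg s t u|V sg [i] t|V sg p IHp q IHq|V sg p IHp q IHq|
    V sg p IHp q IHq|V sg s p IHp|V sg s p IHp] e e' finV he.
- by [].
- have [i hi] := pos_detects_eq s.
  have [k hk] := teval_pos t i true; have [l hl] := teval_pos u i true.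
  have := equ_eq i k l he; rewrite -!hk -!hl => H.
  by split=> /= E; apply: hi; apply/H; rewrite E.
- have [k hk] := teval_pos (t true) i true.
  have [l hl] := teval_pos (t false) i true.
  have := he i k l; rewrite -!hk -!hl /pos !kk_same => H.
  split=> /sat_Rel_Lt h; apply/sat_Rel_Lt; exact/H.
- by have := IHp _ _ finV he; have := IHq _ _ finV he; rewrite /=; tauto.
- by have := IHp _ _ finV he; have := IHq _ _ finV he; rewrite /=; tauto.
- by have := IHp _ _ finV he; have := IHq _ _ finV he; rewrite /=; tauto.
- split=> h m.
    have [m' hm'] := equ_cons m finV (equ_sym he).
    by apply/(IHp _ _ (finite_option finV) hm').
  have [m' hm'] := equ_cons m finV he.
  by apply/(IHp _ _ (finite_option finV) hm').
- split=> -[m hm].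
    have [m' hm'] := equ_cons m finV he; exists m'.
    by apply/(IHp _ _ (finite_option finV) hm').
  have [m' hm'] := equ_cons m finV (equ_sym he); exists m'.
  by apply/(IHp _ _ (finite_option finV) hm').
Qed.

(* The entries of [b] are adjoined one at a time; those not yet treated are
   replaced by elements that lie in the closure of the empty set. *)
Lemma equ_cat (V Z : finType) sg tu (e e' : @env _ M V sg) (b : @env _ M Z tu) :
  equ e e' -> exists b', equ (env_cat e b) (env_cat e' b').
Proof.
move=> he.
have [d [d' [db hd]]] : exists d d' : env M tu,
    (forall z, z \in enum Z -> d z = b z) /\ equ (env_cat e d) (env_cat e' d').
  elim: (enum Z) => [|z s [d [d' [db hd]]]].
    pose dflt s : M s := match s return M s with R0 => zero | R j => ff j zero end.
    exists (fun z => dflt (tu z)), (fun z => dflt (tu z)); split=> //.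
    apply: equ_sub he => i [v|z] b0; first by exists (Some (v, b0)).
    by exists None; rewrite /=; case: (tu z) => [|j] /=; rewrite ?pos_R0 ?pos_ff.
  have [m hm] := equ_cons (b z) (finite_finType _) hd.
  exists (dfwith d (b z)), (dfwith d' m); split=> [w|].
    have [<- _|ne] := eqVneq z w; first by rewrite dfwith_in.
    by rewrite inE eq_sym (negbTE ne) dfwith_out //; apply: db.
  apply: equ_sub hm => i [v|w] b0; first by exists (Some (Some (inl v), b0)).
  have [<-|ne] := eqVneq z w.
    by exists (Some (None, b0)); rewrite /= !dfwith_in.
  by exists (Some (Some (inr w), b0)); rewrite /= !dfwith_out.
exists d'; apply: equ_sub hd => i [v|z] b0; first by exists (Some (inl v, b0)).
by exists (Some (inr z, b0)); rewrite /= db ?mem_enum.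
Qed.

(** * Terms naming the positions, and definability of unions of types *)

Section Terms.
Context {V : Type} {sg : V -> sorts (vo_lang n)}.

Definition tr0 (s : vo_sort n) : @term (vo_lang n) V sg s -> @term (vo_lang n) V sg R0 :=
  match s return @term (vo_lang n) V sg s -> @term (vo_lang n) V sg R0 with
  | R0 => id
  | R j => @tg n V sg j
  end.

Definition tkk (i : 'I_n) (s : vo_sort n) :
    @term (vo_lang n) V sg s -> @term (vo_lang n) V sg (R i) :=
  match s return @term (vo_lang n) V sg s -> @term (vo_lang n) V sg (R i) with
  | R0 => tf i
  | R j => fun t => match @eqP _ j i with
                    | ReflectT e => ecast k (@term (vo_lang n) V sg (R k)) e t
                    | ReflectF _ => tf i (tg j t)
                    end
  end.

Definition tposn (i : 'I_n) (k : option (V * bool)) : @term (vo_lang n) V sg (R i) :=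
  if k is Some (v, b) then if b then tkk i (Var v) else tf i (tr0 (Var v))
  else tf i tzero.

Lemma teval_tposn (e : env M sg) i k : teval e (tposn i k) = posn e i k.
Proof.
have Hr0 s (t : @term (vo_lang n) V sg s) : teval e (tr0 t) = r0 (teval e t).
  by case: s t => [|j] t.
case: k => [[v []]|] /=.
- rewrite /pos -[e v]/(teval e (Var v)); move: (Var v : term sg (sg v)).
  case: (sg v) => [|j] t //=.
  by case: eqP => // ji; case: i / ji.
- by rewrite -[e v]/(teval e (Var v)) -Hr0.
- by rewrite -(teval_zero e (fun a : void => match a with end)).
Qed.

End Terms.

(** A type is decided by finitely many atomic formulas, the comparisons of two positions. *)
Lemma definable (V : finType) (sg : V -> sorts (vo_lang n))
    (D : env M sg -> Prop) :
  (forall e e', equ e e' -> D e -> D e') -> exists phi, forall e, sat e phi <-> D e.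
Proof.
move=> HD; have [l hl] := finite_finType
  ('I_n * option (V * bool) * option (V * bool) : finType)%type.
apply: (@definable_by_list _ _ _ _ _
  (fun t => flt t.1.1 (tposn t.1.1 t.1.2) (tposn t.1.1 t.2)) l) => e e' h.
apply: HD => i k k'; have := h (i, k, k') (hl _).
by rewrite !sat_flt !teval_tposn.
Qed.

(** * Invariance over parameters and removal of a parameter *)

Section Invariance.
Context {X : finType} {sg : X -> vo_sort n} (C : env M sg -> Prop).

Definition invariant Z (tu : Z -> vo_sort n) (b : env M tu) : Prop :=
  forall x y, equ (env_cat x b) (env_cat y b) -> C x -> C y.

(* With [b] fixed, a formula in [(x, c)]; it also forces [c] to have the type of
   [b] as soon as some [x] satisfies it. *)
Definition type_def Z (tu : Z -> vo_sort n) (b c : env M tu) (x : env M sg) :=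
  exists x0, C x0 /\ equ (env_cat x0 b) (env_cat x c).

Lemma type_def_inv Z tu (b c : @env _ M Z tu) :
  (forall x, C x <-> type_def b c x) -> invariant c.
Proof.
move=> h x y xy /h [x0 [Cx0 h0]]; apply/h; exists x0; split=> //.
exact: equ_trans xy.
Qed.

Lemma inv_type_def Z tu (b : @env _ M Z tu) :
  invariant b -> forall x, C x <-> type_def b b x.
Proof.
move=> h x; split=> [Cx|[x0 [Cx0 /h]]]; last exact.
by exists x.
Qed.

(** Each [x] is matched with an [x'] such that [(a, c', x)] and [(a, c, x')] have the same type.
    Invariance over [a] gives [C x <-> C x'], and [type_def] depends on the type only. *)
Lemma type_def_transfer (W Z : finType) tu' tu (a : @env _ M W tu')
    (b c c' : @env _ M Z tu) :
  invariant a -> equ (env_cat a c) (env_cat a c') ->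
  (forall x, C x <-> type_def b c x) -> forall x, C x <-> type_def b c' x.
Proof.
move=> ia cc' h x.
have [x' hx] := equ_cat x (equ_sym cc').
have Cxx' : C x <-> C x'.
  have E : equ (env_cat x a) (env_cat x' a).
    apply: equ_sub hx => i [v|w] d; first by exists (Some (inr v, d)).
    by exists (Some (inl (inl w), d)).
  by split; apply: ia => //; apply: equ_sym.
have E : equ (env_cat x c') (env_cat x' c).
  apply: equ_sub hx => i [v|w] d; first by exists (Some (inr v, d)).
  by exists (Some (inl (inr w), d)).
rewrite Cxx' h; split=> -[x0 [Cx0 h0]]; exists x0; split=> //.
  exact: equ_trans (equ_sym E).
exact: equ_trans E.
Qed.

Lemma pos_zero s i (m : M s) : normal m -> relevant s i ->
  pos true i m = ff i zero -> forall j, pos true j m = ff j zero.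
Proof.
case: s m => [|j] m nm ri; first by rewrite pos_R0 => /ff_inj-> j; rewrite pos_R0.
by case: i / ri => /esym; rewrite /pos kk_same => /nm.
Qed.

(** A point of [R0] is met only through [r0 m'], which is [m'] or [zero]; a normal point of [R j]
    lies outside the image and is met only by itself. *)
Lemma pos_meet s s' b i (m : M s) (m' : M s') : normal m -> normal m' ->
  relevant s i -> pos true i m = pos b i m' ->
  (forall j, pos true j m = pos true j m') \/ (forall j, pos true j m = ff j zero).
Proof.
case: s m => [|j] m nm nm' ri.
  rewrite pos_R0 => /eq_pos_r0 ->.
  case: s' m' nm' => [|j'] m' nm'; first by left=> j.
  by right=> j; rewrite pos_R0 /= (gg_nonimage nm').
case: i / ri; rewrite [pos true j m]/pos kk_same => E; subst m.
move: nm; case: b => [|/(_ (r0 m'))] //.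
case: s' m' nm' => [m' _ /(_ m')|j' m' _] //.
have [<-|/eqP ne] := eqVneq j' j; first by rewrite [pos true j' m']/pos kk_same; left.
by rewrite [pos true j m']/pos kk_diff // => /(_ (gg m')).
Qed.

(* Let p = [b z0], and let [P i] be its positions.  Write b0 for the rest of [b].
   The type of [b'] over [b] is realized by some [B'] having no position between
   [P i] and a point [l i] that lies below [P i] and below every position of x
   and y in the cut of [P i] over b0.  Replacing p in [b] by an element p' whose
   positions are just above [l i] does not change its type over [B'], hence C is
   invariant over (b0, p'); and x, y have the same type over (b0, p'). *)
Lemma inv_remove (Z : finType) tu (b b' : @env _ M Z tu) (z0 : Z) :
  (forall z, normal (b z)) -> (forall z, normal (b' z)) ->
  (exists i, pos true i (b z0) <> ff i zero) ->
  (forall z, z != z0 -> exists i, pos true i (b z0) <> pos true i (b z)) ->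
  (forall z, exists i, pos true i (b z0) <> pos true i (b' z)) ->
  invariant b -> (forall x, C x <-> type_def b b' x) ->
  invariant (fun z : {z | z != z0} => b (val z)).
Proof.
move=> nb nb' pz pb pb' ib hb'; set b0 := (fun z => b (val z)) => x y xy.
pose P i := pos true i (b z0).
pose low i k := lt (posn b0 i k) (P i).
have fresh i k : relevant (tu z0) i -> P i <> posn (env_cat b0 b') i k.
  move=> ri E; case: pz => j; apply; move: j.
  case: k E => [[[[z zz0]|z] c]|] /= E; last exact: pos_zero (nb z0) ri E.
    have [H|//] := pos_meet (nb z0) (nb z) ri E.
    by have [j] := pb z zz0; rewrite H.
  have [H|//] := pos_meet (nb z0) (nb' z) ri E.
  by have [j] := pb' z; rewrite H.
have splitb i k : (exists k0, posn b i k = posn b0 i k0) \/ posn b i k = P i.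
  case: k => [[z c]|]; last by left; exists None.
  have [->|zz0] := eqVneq z z0; last by left; exists (Some (exist _ z zz0, c)).
  by have [[h _]|[h _ _]] := pos_cases c i (nb z0) (nb z0);
    [left; exists None | right].
(* The interval from [u] to [v] sits at the bottom of the cut of [P i]: no low point exceeds [u],
   and [v] exceeds neither [P i] nor any position of [x], [y] or [b0] above all low points. *)
have cut i : exists u v, [/\ lt u v, forall k, low i k -> ~ lt u (posn b0 i k),
    ~ lt (P i) v,
    forall k, (forall k0, low i k0 -> lt (posn b0 i k0) (posn (env_cat x b0) i k)) ->
      ~ lt (posn (env_cat x b0) i k) v &
    forall k, (forall k0, low i k0 -> lt (posn b0 i k0) (posn (env_cat y b0) i k)) ->
      ~ lt (posn (env_cat y b0) i k) v].
  (* One interval has to serve both [x] and [y]; in the family below the extra index [None] stands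
     for [P i]. *)
  pose ea := env_cat (env_cat x y) b0.
  have [||u [v [uv H]]] := @between_family _ i (oapp (posn ea i) (P i))
    (fun k => exists2 k0, low i k0 & oapp (posn ea i) (P i) k = posn b0 i k0)
    (fun k => forall k0, low i k0 -> lt (posn b0 i k0) (oapp (posn ea i) (P i) k)).
  - exact/finite_option/finite_posn/finite_finType.
  - by move=> k k' [k0 lk0 ->]; apply.
  exists u, v; split=> // [k lk||k|k].
  - case: k lk => [[z c]|] lk.
      by apply: (H (Some (Some (inr z, c)))).1; exists (Some (z, c)).
    by apply: (H (Some None)).1; exists None.
  - exact: (H None).2.
  - case: k => [[[w|z] c]|].
    + exact: (H (Some (Some (inl (inl w), c)))).2.
    + exact: (H (Some (Some (inr z, c)))).2.
    + exact: (H (Some None)).2.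
  - case: k => [[[w|z] c]|].
    + exact: (H (Some (Some (inl (inr w), c)))).2.
    + exact: (H (Some (Some (inr z, c)))).2.
    + exact: (H (Some None)).2.
have [u /fin_all_exists [v Huv]] := fin_all_exists cut.
(* [near] gives the points playing the role of [l i] with respect to [b']. *)
have near i : exists l, [/\ forall w, ff i w <> l, lt l (P i) &
    forall k, lt (posn (env_cat b0 b') i k) (P i) -> lt (posn (env_cat b0 b') i k) l].
  have [||t [t' [tt' H]]] := @between_family _ i (oapp (posn (env_cat b0 b') i) (P i))
    (fun k => lt (oapp (posn (env_cat b0 b') i) (P i) k) (P i)) (fun k => k = None).
  - exact/finite_option/finite_posn/finite_finType.
  - by move=> k _ h ->.
  have [l [nl [tl lt']]] := codense tt'; exists l; split=> //.
    exact: lt_nlt_trans lt' ((H None).2 _).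
  by move=> k hk; apply: nlt_lt_trans tl; apply: (H (Some k)).1.
have [ls Hls] := fin_all_exists near.
have far i : exists l, [/\ forall w, ff i w <> l, lt (u i) l & lt l (v i)].
  by have [uv _ _ _ _] := Huv i; have [l [? [? ?]]] := codense uv; exists l.
have [l Hl] := fin_all_exists far.
have lP i : lt (l i) (P i).
  by have [_ _ h _ _] := Huv i; have [_ _ h'] := Hl i; apply: lt_nlt_trans h' h.
have lowl i k : low i k -> lt (posn b0 i k) (l i).
  by move=> lk; have [_ h _ _ _] := Huv i; have [_ h' _] := Hl i;
    apply: nlt_lt_trans h'; apply: h.
have lowls i k : low i k -> lt (posn b0 i k) (ls i).
  have [_ _ h] := Hls i.
  by case: k => [[z c]|]; [exact: (h (Some (inl z, c))) | exact: (h None)].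
have cutP i t : lt t (P i) -> (forall k, low i k -> lt (posn b0 i k) t) ->
    forall k, (lt (posn b0 i k) t <-> low i k) /\ (lt t (posn b0 i k) <-> ~ low i k).
  move=> tP ht k; split; (split=> [h|]; last first).
  - exact: ht.
  - exact: lt_trans tP.
  - by move/nlt_eq_or_gt=> [->|h] //; apply: lt_trans h.
  - by move=> lk; have := lt_trans h (ht _ lk); apply: lt_irr.
(* By [cutP], [ls i] and [l i] fill the same cut over [b0], and both lie below [P i]; hence they
   fill the same cut over [b]. *)
have bl : equ (@env_cat _ M _ _ tu (@R n) b ls) (@env_cat _ M _ _ tu (@R n) b l).
  apply: (@equ_new _ _ b b _ _ _ _ (fun=> True) ls l) => //.
    move=> i [z|j] c; first by left; exists (Some (z, c)).
    have [nls _ _] := Hls j; have [nl _ _] := Hl j.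
    have [[h h']|[-> -> ji]] := @pos_cases (R j) (ls j) (l j) c i nls nl.
      by left; exists None.
    by right; case: i / ji; rewrite /pos !kk_same.
  move=> i k _; have [_ lsP _] := Hls i; have [[k0 ->]|->] := splitb i k.
    have [-> ->] := cutP i _ lsP (lowls i) k0.
    by have [-> ->] := cutP i _ (lP i) (lowl i) k0.
  split; split=> // h; first by case: (@lt_irr i (P i)); apply: lt_trans h lsP.
  by case: (@lt_irr i (P i)); apply: lt_trans h (lP i).
(* Moving [ls] to [l] over [b] carries [b'] to [B'], so the gap below [P i] now reaches down to
   [l i]. *)
have [B' hB] := equ_cat b' bl.
have hB1 : equ (env_cat b b') (env_cat b B').
  apply: equ_sub hB => i [z|z] c; first by exists (Some (inl (inl z), c)).
  by exists (Some (inr z, c)).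
have hB2 i k : [/\ lt (posn (env_cat b0 B') i k) (P i) ->
    lt (posn (env_cat b0 B') i k) (l i) &
    relevant (tu z0) i -> P i <> posn (env_cat b0 B') i k].
  pose K : option ((Z + 'I_n + Z) * bool) := match k with
    | Some (inl z, c) => Some (inl (inl (val z)), c)
    | Some (inr z, c) => Some (inr z, c)
    | None => None end.
  pose KP : option ((Z + 'I_n + Z) * bool) := Some (inl (inl z0), true).
  pose Kl : option ((Z + 'I_n + Z) * bool) := Some (inl (inr i), true).
  have E1 : posn (env_cat b0 b') i k = posn (env_cat (@env_cat _ M _ _ tu (@R n) b ls) b') i K.
    by case: k @K => [[[z|z] c]|].
  have E2 : posn (env_cat b0 B') i k = posn (env_cat (@env_cat _ M _ _ tu (@R n) b l) B') i K.
    by case: k @K {E1} => [[[z|z] c]|].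
  have Els : ls i = posn (env_cat (@env_cat _ M _ _ tu (@R n) b ls) b') i Kl.
    by rewrite -[LHS]kk_same.
  have El : l i = posn (env_cat (@env_cat _ M _ _ tu (@R n) b l) B') i Kl.
    by rewrite -[LHS]kk_same.
  have [_ _ hls] := Hls i.
  split; first by rewrite E2 El => /(hB i K KP); rewrite -E1 => /hls;
    rewrite E1 Els => /(hB i K Kl).
  move=> ri; rewrite E2 => /(equ_eq i KP K hB); rewrite -E1; exact: fresh.
have [p [np hp]] := @box (tu z0) l v (fun i => let: And3 _ _ h := Hl i in h).
have pP i : relevant (tu z0) i -> lt (pos true i p) (P i).
  by case/hp => _ h; have [_ _ h' _ _] := Huv i; apply: lt_nlt_trans h h'.
pose b2 := dfwith b p.
(* The relevant positions of [p] lie in the gap between [l i] and [P i], which contains no position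
   of [b0] or [B']. *)
have hB3 : equ (env_cat B' b) (env_cat B' b2).
  apply: (@equ_new _ _ (env_cat b0 B') (env_cat b0 B') _ _ _ _
    (relevant (tu z0)) P (fun i => pos true i p)) => //.
    move=> i [z|z] c /=; first by left; exists (Some (inr z, c)).
    have [->|zz0] := eqVneq z z0; last first.
      left; exists (Some (inl (exist _ z zz0), c)).
      by rewrite /b2 dfwith_out // eq_sym.
    rewrite /b2 dfwith_in.
    have [[h h']|H] := pos_cases c i (nb z0) np; last by right.
    by left; exists None.
  move=> i k ri; have [h1 h2] := hB2 i k; have [lp _] := hp i ri.
  split; split=> h.
  - exact: lt_trans (h1 h) lp.
  - exact: lt_trans h (pP i ri).
  - exact: lt_trans (pP i ri) h.
  - have [//|[/(h2 ri) //|/h1 h']] := lt_total (P i) (posn (env_cat b0 B') i k).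
    by case: (@lt_irr i (l i)); apply: lt_trans lp (lt_trans h h').
(* The definition of [C] is carried from [b'] to [B'] over [b], and then from [b] to [b2] over
   [B']. *)
have iB : invariant B'.
  exact/type_def_inv/(type_def_transfer ib hB1 hb').
have ib2 : invariant b2.
  exact/type_def_inv/(type_def_transfer iB hB3)/inv_type_def.
apply: ib2; apply: (@equ_new _ _ (env_cat x b0) (env_cat y b0) _ _ _ _
    (relevant (tu z0)) (fun i => pos true i p) (fun i => pos true i p)) => //.
  move=> i [w|z] c /=; first by left; exists (Some (inl w, c)).
  have [->|zz0] := eqVneq z z0; last first.
    left; exists (Some (inr (exist _ z zz0), c)).
    by rewrite /b2 dfwith_out // eq_sym.
  rewrite /b2 dfwith_in.
  have [[h h']|H] := pos_cases c i np np; last by right.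
  by left; exists None.
move=> i k ri; have [lp pv] := hp i ri; have [uv hu _ hx hy] := Huv i.
have lift k0 : exists K, forall z : env M sg, posn b0 i k0 = posn (env_cat z b0) i K.
  by case: k0 => [[z c]|]; [exists (Some (inr z, c)) | exists None].
(* A position of [x] above all low points is at least [v i], hence above that of [p]; any other is
   at most some low point, hence below it. The type over [b0] puts [y] on the same side. *)
have [hi|nhi] := classic
    (forall k0, low i k0 -> lt (posn b0 i k0) (posn (env_cat x b0) i k)).
  have hi' k0 : low i k0 -> lt (posn b0 i k0) (posn (env_cat y b0) i k).
    have [K hK] := lift k0; have := xy i K k; rewrite -!hK => H lk0.
    exact/H/hi.
  have h1 : lt (pos true i p) (posn (env_cat x b0) i k) := lt_nlt_trans pv (hx k hi).
  have h2 : lt (pos true i p) (posn (env_cat y b0) i k) := lt_nlt_trans pv (hy k hi').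
  split; split=> // h; first by have /lt_irr := lt_trans h h1.
  by have /lt_irr := lt_trans h h2.
have [k0 hk0] := not_all_ex_not _ _ nhi.
have [lk0 nlt] := imply_to_and _ _ hk0.
have nlt' : ~ lt (posn b0 i k0) (posn (env_cat y b0) i k).
  by have [K hK] := lift k0; have := xy i K k; rewrite -!hK => H /H.
have qp : lt (posn b0 i k0) (pos true i p) by apply: lt_trans (lowl _ _ lk0) lp.
have h1 := nlt_lt_trans nlt qp; have h2 := nlt_lt_trans nlt' qp.
split; split=> // h; first by have /lt_irr := lt_trans h h1.
by have /lt_irr := lt_trans h h2.
Qed.

End Invariance.

(** * A minimal parameter of the class, and its uniqueness *)

Lemma normal_transfer s (m m' : M s) :
  (forall i, pos true i m = pos false i m <-> pos true i m' = pos false i m') ->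
  normal m -> normal m'.
Proof.
case: s m m' => [|j] m m' // h nm x E; apply: (nm (r0 m)).
have : pos true j m = pos false j m by apply/h; rewrite -E !pos_ff.
by rewrite [pos true j m]/pos kk_same.
Qed.

Lemma class_parameter (X : finType) sg (E : @formula (vo_lang n) _ (sort_cat sg sg))
    (a : @env _ M X sg) : sat (env_cat a a) E ->
  exists (Z : finType) (tu : Z -> sorts (vo_lang n)) (phi : formula (sort_cat sg tu)),
  exists! b : env M tu,
  forall x : env M sg, sat (env_cat x b) phi <-> sat (env_cat a x) E.
Proof.
set C := fun x : env M sg => sat (env_cat a x) E => Ca.
pose good m := exists (Z : finType) (tu : Z -> vo_sort n) (b : env M tu),
  [/\ #|Z| = m, forall z, normal (b z) & invariant C b].
(* The representative [a], made normal entry by entry, is a first candidate. *)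
have good0 : good #|X|.
  have ex x : exists c : {s : vo_sort n & M s}, normal (projT2 c) /\
      forall i b, pos b i (a x) = pos b i (projT2 c).
    have [s [m [nm h]]] := pos_normal (a x).
    by exists (existT _ s m).
  have [c hc] := fin_all_exists ex.
  exists X, (fun x => projT1 (c x)), (fun x => projT2 (c x)); split=> // [x|x y xy].
    exact: (hc x).1.
  suff h : equ (env_cat a x) (env_cat a y) by apply: (proj1 (sat_equ E (finite_finType _) h)).
  apply: equ_sub xy => i [v|v] b; last by exists (Some (inl v, b)).
  by exists (Some (inr v, b)); rewrite /= (hc v).2.
have [m [[Z [tu [b [Zm nb ib]]]] mmin]] := least_nat good0.
have noremove z0 : ~ invariant C (fun z : {z | z != z0} => b (val z)).
  move=> h; suff /mmin : #|{: {z | z != z0}}| < m.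
    apply; exists ({z | z != z0} : finType), (fun z => tu (val z)), (fun z => b (val z)).
    by split.
  rewrite card_sig -Zm -(cardC (pred1 z0)) card1 add1n ltnS; apply: eq_leq.
  by apply: eq_card => z; rewrite !inE.
(* An entry that generates nothing beyond the others and the constant could be dropped, against
   minimality. *)
have noredundant z0 : ~ (forall i c, exists k,
    pos c i (b z0) = posn (fun z : {z | z != z0} => b (val z)) i k).
  move=> h; apply: (@noremove z0) => x y xy; apply: ib; apply: equ_sub xy => i [v|z] c.
    by exists (Some (inl v, c)).
  have [->|zz0] := eqVneq z z0; last by exists (Some (inr (exist _ z zz0), c)).
  have [[[w d]|] hk] := h i c; last by exists None.
  by exists (Some (inr w, d)).
have nonzero z : exists i, pos true i (b z) <> ff i zero.
  apply: not_all_ex_not => h; apply: (@noredundant z) => i c; exists None.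
  by rewrite (@pos_true_same_normal _ R0 (b z) zero (nb z) I) ?pos_R0.
have distinct z z' : z' != z -> exists i, pos true i (b z) <> pos true i (b z').
  move=> ne; apply: not_all_ex_not => h; apply: (@noredundant z) => i c.
  exists (Some (exist _ z' ne, c)).
  exact: (pos_true_same_normal (nb z) (nb z') h).
have [phi hphi] := @definable _ (sort_cat sg tu)
  (fun e => exists x0, C x0 /\ equ (env_cat x0 b) e)
  (fun e e' h => fun '(ex_intro x0 (conj Cx0 h0)) =>
     ex_intro _ x0 (conj Cx0 (equ_trans h0 h))).
exists Z, tu, phi, b; split=> [x|b' hb'].
  by rewrite hphi; apply: iff_sym; apply: inv_type_def.
have {}hb' x : C x <-> type_def C b b' x by rewrite -[C x]/(sat _ E) -hb' hphi.
(* As [a] lies in [C], some [(x0, b)] has the type of [(a, b')]. *)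
have bb' : equ b b'.
  have [x0 [_ h]] := (hb' a).1 Ca.
  by apply: equ_sub h => i z c; exists (Some (inr z, c)).
have nb' z : normal (b' z).
  apply: normal_transfer (nb z) => i.
  exact: (equ_eq i (Some (z, true)) (Some (z, false)) bb').
have found z : exists w, forall i, pos true i (b z) = pos true i (b' w).
  apply: NNPP => h; apply: (@noremove z); apply: (inv_remove nb nb' _ _ _ ib hb') => //.
    by move=> w /distinct.
  move=> w; apply: not_all_ex_not => hw; apply: h; by exists w.
have [f hf] := fin_all_exists found.
have fI : injective f.
  move=> z z' E'; have [//|/distinct[i]] := eqVneq z z'.
  by rewrite !hf E'.
apply: functional_extensionality_dep => z; apply: pos_true_inj => i.
(* Since [b z] has the positions of [b' (f z)], an inequality between entries of [b] is one between
   entries of [b'], and [bb'] takes it back to [b]. *)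
have bE z1 z2 : lt (pos true i (b z1)) (pos true i (b z2)) ->
    lt (pos true i (b (f z1))) (pos true i (b (f z2))).
  by rewrite (hf z1) (hf z2) => /(proj2 (bb' i (Some (f z1, true)) (Some (f z2, true)))).
(* The order excludes that [f] moves an entry upwards, its converse that [f] moves one downwards. *)
have zfz : pos true i (b z) = pos true i (b (f z)).
  have [h|[//|h]] := lt_total (pos true i (b z)) (pos true i (b (f z))).
    case: (@order_automorphism_fix Z (fun z1 z2 => lt (pos true i (b z1)) (pos true i (b z2)))
      f z _ _ fI bE h) => [x|x y t]; [exact: lt_irr | exact: lt_trans].
  case: (@order_automorphism_fix Z (fun z1 z2 => lt (pos true i (b z2)) (pos true i (b z1)))
    f z _ _ fI (fun _ _ => bE _ _) h) => [x|x y t xy yt]; [exact: lt_irr|].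
  exact: lt_trans yt xy.
rewrite hf; apply: esym.
exact: (proj1 (equ_eq i (Some (z, true)) (Some (f z, true)) bb')).
Qed.

End Model.

Theorem theorem3p10 (n : nat) (hn : 1 <= n) :
  elimination_of_imaginaries (VO n).
Proof.
move=> M MVO X sg E EE a.
by apply: class_parameter => //; apply: (@Equivalence_Reflexive _ _ EE a).
Qed.
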